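(* Let $H$ be a connected graph, $\mathbf H \in \mathcal H$ a pattern relaxation of $H$ with stem $\bar x$, and $\mathbf H = \mathbf H_1 \oplus_{\bar x} \mathbf H_2$. Let $V_1 := V(\mathbf H_1) \setminus \bar x$ and $V_2 := V(\mathbf H_2) \setminus \bar x$. Let $\mathcal D'$ be the set of etogs generated by the following process, over all possible choices: (1) choose subsets $\tilde V_1 \subseteq V_1$, $\tilde V_2 \subseteq V_2$ and a defect map $\kappa: \bar x \cup \tilde V_1 \to \bar x \cup \tilde V_2$, and let $M := \{x\kappa(x) : x \in \tilde V_1\}$; (2) identify each pair $\{x, \kappa(x)\}$, $x \in \tilde V_1$, of $H$ into a single vertex labelled $x$, obtaining a graph $H'$, and let $\preccurlyeq_M$ be the partial order on $V(H')$ obtained from $\preccurlyeq_{\mathbf H}$ by the same identification (the reachability order of the dag obtained from the digraph representation of $\preccurlyeq_{\mathbf H}$ by identifying the pairs in $M$); (3) choose a set $E^+ \subseteq (V_1 \setminus \tilde V_1) \times (V_2 \setminus \tilde V_2)$ with $E^+ \cap E(H) = \emptyset$ and add it to $H'$, where $E^+ = \emptyset$ is allowed only if $\tilde V_1, \tilde V_2 \neq \emptyset$; (4) for every linear order $\leq$ of $V(H')$ that extends $\preccurlyeq_M$, add $\operatorname{rel}((H', \leq))$ to $\mathcal D'$. Then $\mathcal D' = \operatorname{defects}(\mathbf H_1, \mathbf H_2)$.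
   Context: A tree order on a finite set is a partial order $\preccurlyeq$ such that for every $x$ the set $\{y : y \preccurlyeq x\}$ is totally ordered. A tree-ordered graph (tog) $\mathbf G = (G, \preccurlyeq_{\mathbf G})$ is a finite graph with a tree order on $V(G)$ such that every edge $uv$ has $u \preccurlyeq_{\mathbf G} v$ or $v \preccurlyeq_{\mathbf G} u$; if the order is total it is a linear graph. $\mathbf G[X] = (G[X], \preccurlyeq_{\mathbf G}|_X)$. The root path of $x$ is $\{y : y \preccurlyeq_{\mathbf G} x\}$; leaves are $\preccurlyeq_{\mathbf G}$-maximal vertices. The stem of $\mathbf G$ is the sequence $\bar x$ of maximal length that is totally ordered by $\preccurlyeq_{\mathbf G}$ and satisfies $\max \bar x \preccurlyeq_{\mathbf G} u$ for all $u \in V(\mathbf G)\setminus \bar x$. For a connected linear graph $\mathbb H$, its elimination tree $\operatorname{ET}(\mathbb H)$ has root $x = \min \mathbb H$ whose children are the roots of $\operatorname{ET}(\mathbb K_i)$ for the components $\mathbb K_i$ of $\mathbb H - x$; $\operatorname{rel}(\mathbb H) = (H, \preccurlyeq)$ with $u \preccurlyeq v$ iff $u$ is an ancestor of or equal to $v$ in $\operatorname{ET}(\mathbb H)$. An etog is a tog of the form $\operatorname{rel}(\mathbb H)$. For a connected graph $H$, $\mathcal H = \{\operatorname{rel}((H,\leq)) : \leq \text{ a linear order of } V(H)\}$. For a tog $\mathbf H$ and a nonempty set $S$ of its leaves, the piece induced by $S$ is $\mathbf H[\bigcup_{x \in S}\text{rootpath}(x)]$. For $\mathbf H$ with stem $\bar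 x$, $\mathbf H = \mathbf H_1 \oplus_{\bar x} \mathbf H_2$ means $\mathbf H_1, \mathbf H_2$ are pieces of $\mathbf H$ whose leaf sets are nonempty and partition the leaves of $\mathbf H$. An embedding of tog $\mathbf H$ into tog $\mathbf G$ is an injective $\phi: V(H) \to V(G)$ with $uv \in E(H) \iff \phi(u)\phi(v) \in E(G)$ and $u \preccurlyeq_{\mathbf H} v \implies \phi(u) \preccurlyeq_{\mathbf G} \phi(v)$. The digraph representation of a partial order $\preccurlyeq$ on $S$ has vertex set $S$ and arcs $xy$ for $x \prec y$. A matching $M$ on $S$ is monotone with respect to $\preccurlyeq$ if the digraph obtained from the digraph representation of $\preccurlyeq$ by identifying the pairs in $M$ is acyclic. A defect map is a bijection $\kappa: \bar x \cup \tilde V_1 \to \bar x \cup \tilde V_2$ ($\tilde V_1 \subseteq V_1$, $\tilde V_2 \subseteq V_2$) that is an isomorphism between $H[\bar x \cup \tilde V_1]$ and $H[\bar x \cup \tilde V_2]$ and such that the matching $\{x\kappa(x) : x \in \tilde V_1\}$ is monotone with respect to $\preccurlyeq_{\mathbf H}$. A defect of $\mathbf H_1, \mathbf H_2$ is an etog $\mathbf D$ such that: (1) there is no embedding of $\mathbf H$ into $\mathbf D$; (2) $V(\mathbf H_1) \subseteq V(\mathbf D)$ and the identity is an embedding of $\mathbf H_1$ into $\mathbf D$; (3) there is an embedding $\phi$ of $\mathbf H_2$ into $\mathbf D$ with $\phi(v) = v$ for every $v \in \bar x$ and every $v \in V(\mathbf H_2)$ with $\phi(v) \notin V(\mathbf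 H_1)$; (4) $V(\mathbf D) = V(\mathbf H_1) \cup \phi(V(\mathbf H_2))$. $\operatorname{defects}(\mathbf H_1, \mathbf H_2)$ is the set of all defects.
   Formalization: Two conditions implicit in the English are made explicit, and the claim fails without them: a defect map κ fixes every vertex of the stem x̄, and H = H₁ ⊕ H₂ along x̄ also requires V(H₁) ∩ V(H₂) = x̄, so no branch below the stem is split between the pieces. *)

(* Defs.v *)
From mathcomp Require Import all_boot.

Set Implicit Arguments.
Unset Strict Implicit.
Unset Printing Implicit Defensive.

Section Digraphs.
Variable T : finType.
Implicit Types (A M : {set T * T}) (S : {set T}).

Definition arc A : rel T := [rel u v | (u, v) \in A].

(* Loops are cycles. *)
Definition acyclic A : Prop := forall c : seq T, cycle (arc A) c -> c = [::].

Definition reachability S A : {set T * T} :=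
  [set e in setX S S | connect (arc A) e.1 e.2].

(* Arcs of the digraph representation of the partial order [A]. *)
Definition strict A : {set T * T} := [set e in A | e.1 != e.2].

(* A matching is a set of pairs (x, y); identifying x and y keeps the label x. *)
Definition merge M (v : T) : T := if [pick x | (x, v) \in M] is Some x then x else v.
Definition merge_arcs M A : {set T * T} :=
  [set (merge M e.1, merge M e.2) | e in A].

Definition monotone A M : Prop := acyclic (merge_arcs M (strict A)).

End Digraphs.

(* Vertices are drawn from an ambient finite type [T], so that graphs on
   different (overlapping) vertex sets can be compared by Leibniz equality. *)
Record graph (T : finType) := Graph { gV : {set T}; gE : {set T * T} }.

Record tog (T : finType) := Tog { tgraph :> graph T; tle : {set T * T} }.

Section Togs.
Variable T : finType.
Implicit Types (H : graph T) (G D : tog T) (X S xs : {set T}) (phi kappa : T -> T).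

Definition adj H u v : bool := (u, v) \in gE H.
Definition le G u v : bool := (u, v) \in tle G.

Definition is_graph H : Prop :=
  [/\ gE H \subset setX (gV H) (gV H), symmetric (adj H) & irreflexive (adj H)].

Definition connected H : Prop :=
  gV H != set0 /\ {in gV H &, forall u v, connect (adj H) u v}.

Definition components H : {set {set T}} :=
  equivalence_partition (connect (adj H)) (gV H).

Definition is_tree_order G : Prop :=
  [/\ tle G \subset setX (gV G) (gV G),
      {in gV G, reflexive (le G)}, antisymmetric (le G), transitive (le G)
    & forall x y z, le G y x -> le G z x -> le G y z || le G z y].

Definition is_tog G : Prop :=
  [/\ is_graph G, is_tree_order G & forall u v, adj G u v -> le G u v || le G v u].

Definition is_linear G : Prop :=
  is_tog G /\ {in gV G &, forall u v, le G u v || le G v u}.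

Definition induced G X : tog T :=
  Tog (Graph (gV G :&: X) (gE G :&: setX X X)) (tle G :&: setX X X).

Definition rootpath G x : {set T} := [set y | le G y x].

Definition leaves G : {set T} :=
  [set x in gV G | [forall y in gV G, le G x y ==> (y == x)]].

(* The stem is totally ordered, hence determined by its set of entries. *)
Definition stem_candidate G X : Prop :=
  [/\ X \subset gV G, {in X &, forall u v, le G u v || le G v u}
    & forall m, m \in X -> {in X, forall y, le G y m} ->
        {in gV G :\: X, forall u, le G m u}].

Definition is_stem G X : Prop :=
  stem_candidate G X /\ forall Y, stem_candidate G Y -> #|Y| <= #|X|.

Definition min_vertex G : option T :=
  [pick x in gV G | [forall y in gV G, le G x y]].

(* Parent-to-child arcs of the elimination tree; [n] bounds the recursion depth. *)
Fixpoint ET_rec (n : nat) G : {set T * T} :=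
  if n is n'.+1 then
    if min_vertex G is Some x then
      \bigcup_(K in components (induced G (gV G :\ x)))
        ([set e | (e.1 == x) && (Some e.2 == min_vertex (induced G K))]
         :|: ET_rec n' (induced G K))
    else set0
  else set0.

Definition ET G : {set T * T} := ET_rec #|gV G| G.

Definition rel_tog G : tog T := Tog G (reachability (gV G) (ET G)).

Definition is_etog D : Prop :=
  exists L : tog T, [/\ is_linear L, connected L & D = rel_tog L].

Definition pattern_relaxation H G : Prop :=
  exists lo : {set T * T}, is_linear (Tog H lo) /\ G = rel_tog (Tog H lo).

Definition piece G S : tog T := induced G (\bigcup_(x in S) rootpath G x).

(* Gluing along the stem: the pieces overlap exactly in [xs].  A partition of the
   leaves alone would allow a branch below the stem to be split between the two
   pieces. *)
Definition is_decomposition G xs (G1 G2 : tog T) : Prop :=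
  exists S1 S2 : {set T},
    [/\ S1 != set0 /\ S2 != set0, [disjoint S1 & S2], S1 :|: S2 = leaves G,
        G1 = piece G S1 /\ G2 = piece G S2
      & gV G1 :&: gV G2 = xs].

(* Only the values of [phi] on the vertices of the source matter. *)
Definition embedding (G D : tog T) phi : Prop :=
  [/\ {in gV G, forall v, phi v \in gV D},
      {in gV G &, injective phi},
      {in gV G &, forall u v, adj G u v = adj D (phi u) (phi v)}
    & {in gV G &, forall u v, le G u v -> le D (phi u) (phi v)}].

Definition matching_of kappa (W1 : {set T}) : {set T * T} :=
  [set (x, kappa x) | x in W1].

(* [W1], [W2] are the subsets of V_1, V_2 on which the defect map acts.  The stem
   is fixed pointwise: its vertices keep their identity in a defect. *)
Definition defect_map G xs (W1 W2 : {set T}) kappa : Prop :=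
  [/\ {in xs, forall x, kappa x = x},
      {in xs :|: W1 &, injective kappa},
      kappa @: (xs :|: W1) = xs :|: W2,
      {in xs :|: W1 &, forall u v, adj G u v = adj G (kappa u) (kappa v)}
    & monotone (tle G) (matching_of kappa W1)].

(* H' with the edges of [Ep] added. *)
Definition merged_graph G (M Ep : {set T * T}) : graph T :=
  Graph (merge M @: gV G)
        (merge_arcs M (gE G) :|: Ep :|: [set (e.2, e.1) | e in Ep]).

Definition merged_order G (M : {set T * T}) : {set T * T} :=
  reachability (merge M @: gV G) (merge_arcs M (strict (tle G))).

Definition generated_defect G xs (G1 G2 : tog T) D : Prop :=
  let V1 := gV G1 :\: xs in
  let V2 := gV G2 :\: xs in
  exists (W1 W2 : {set T}) (kappa : T -> T) (Ep lo : {set T * T}),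
    let M := matching_of kappa W1 in
    let H' := merged_graph G M Ep in
    [/\ [/\ W1 \subset V1, W2 \subset V2 & defect_map G xs W1 W2 kappa],
        [/\ Ep \subset setX (V1 :\: W1) (V2 :\: W2), [disjoint Ep & gE G]
          & Ep = set0 -> W1 != set0 /\ W2 != set0],
        is_linear (Tog H' lo) /\ merged_order G M \subset lo
      & D = rel_tog (Tog H' lo)].

Definition is_defect G xs (G1 G2 : tog T) D : Prop :=
  [/\ is_etog D,
      ~ (exists phi, embedding G D phi),
      gV G1 \subset gV D /\ embedding G1 D id
    & exists phi : T -> T,
        [/\ embedding G2 D phi,
            {in xs, forall v, phi v = v},
            {in gV G2, forall v, phi v \notin gV G1 -> phi v = v}
          & gV D = gV G1 :|: phi @: gV G2]].

End Togs.

(* Main.v *)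
From mathcomp Require Import all_boot.
Require Import Defs.

(** In [rel_tog G], [u] lies below [v] iff [G] has a path from [u] to [v] all of
    whose vertices are at least [u].  Comparable vertices of [bH] lie in a common
    piece, so there is no edge between [V1] and [V2].

    Given a generated [D], [merge M] is injective on each piece and preserves the
    tree order because it maps such paths to such paths; it thus embeds both
    pieces.  It is not an embedding of the whole pattern, and no map is, since [D]
    has fewer vertices than [bH] or the same vertices and more edges.

    Conversely, for a defect with embedding [phi] of [H2], let [W2] be the part of
    [V2] sent into [H1], let [kappa] invert [phi] on [phi @: W2], and let [Ep] be
    the edges of [D] not contained in the image of a piece.  Every merged arc is then
    a strict relation of [D], which gives monotonicity and the extension property;
    if nothing is merged or added, [D] contains the pattern. *)

Set Implicit Arguments.
Unset Strict Implicit.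
Unset Printing Implicit Defensive.

(** * Walks in finite digraphs *)

Lemma connect_morph (S T : finType) (e : rel S) (e' : rel T) (f : S -> T)
    (P : pred S) :
    (forall a b, P a -> e a b -> e' (f a) (f b) && P b) ->
  forall a b, P a -> connect e a b -> connect e' (f a) (f b) && P b.
Proof.
move=> eP a b Pa /connectP[p]; elim: p a Pa => [|c p IHp] a Pa /=.
  by move=> _ ->; rewrite connect0.
case/andP=> /(eP _ _ Pa) /andP[e'ac Pc] /(IHp _ Pc) cp /cp /andP[cb ->].
by rewrite andbT (connect_trans (connect1 e'ac)).
Qed.

(** Along a closed walk a transitive relation would relate the first vertex to itself. *)
Lemma acyclic_suborder (T : finType) (A : {set T * T}) (r : rel T) :
  transitive r -> irreflexive r -> subrel (arc A) r -> acyclic A.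
Proof.
move=> tr ir sub [|x p] //= /(sub_path sub) /(order_path_min tr).
by rewrite all_rcons ir.
Qed.

(** * Elimination trees described by paths *)

Section EliminationTree.
Variable T : finType.
Implicit Types (G : tog T) (H : graph T) (X K : {set T}).

Lemma adj_gV H u v : is_graph H -> adj H u v -> (u \in gV H) && (v \in gV H).
Proof. by case=> /subsetP sub _ _ /sub; rewrite inE. Qed.

Lemma adj_induced G X u v :
  adj (induced G X) u v = [&& adj G u v, u \in X & v \in X].
Proof. by rewrite /adj !inE. Qed.

Lemma le_induced G X u v :
  le (induced G X) u v = [&& le G u v, u \in X & v \in X].
Proof. by rewrite /le !inE. Qed.

Lemma is_graph_induced G X : is_graph G -> is_graph (induced G X).
Proof.
case=> /subsetP sub sym irr; split.
- apply/subsetP=> -[a b]; rewrite !inE /= => /and3P[/sub ab aX bX].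
  by move: ab; rewrite inE /= aX bX !andbT.
- by move=> a b; rewrite !adj_induced sym [(a \in X) && _]andbC.
- by move=> a; rewrite adj_induced irr.
Qed.

Lemma is_linear_induced G X : is_linear G -> is_linear (induced G X).
Proof.
case=> -[gG [/subsetP sub refl anti trans tree] comp] tot.
split; last first.
  move=> a b; rewrite !inE => /andP[aG aX] /andP[bG bX].
  by rewrite !le_induced aX bX !andbT tot.
split; first exact: is_graph_induced.
- split.
  + apply/subsetP=> -[a b]; rewrite !inE /= => /and3P[/sub ab aX bX].
    by move: ab; rewrite inE /= aX bX !andbT.
  + by move=> a; rewrite inE => /andP[aG aX]; rewrite le_induced aX refl.
  + move=> a b; rewrite !le_induced.
    by case/andP=> /and3P[ab _ _] /and3P[ba _ _]; apply: anti; rewrite ab.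
  + move=> b a c; rewrite !le_induced.
    by case/and3P=> ab -> _ /and3P[bc _ ->]; rewrite (trans b).
  + move=> x y z; rewrite !le_induced => /and3P[yx -> _] /and3P[zx -> _].
    by rewrite !andbT (tree x).
- move=> u v; rewrite adj_induced !le_induced => /and3P[uv -> ->].
  by rewrite !andbT comp.
Qed.

Lemma min_vertexP G x : min_vertex G = Some x ->
  x \in gV G /\ {in gV G, forall y, le G x y}.
Proof.
rewrite /min_vertex; case: pickP => // z /andP[zG /forall_inP zmin] [<-].
by split.
Qed.

(** A vertex with the smallest root path works: anything below it has a root path contained in,
    hence equal to, its own. *)
Lemma min_vertex_exists G x0 : is_linear G -> x0 \in gV G ->
  exists x, min_vertex G = Some x.
Proof.
case=> -[_ [_ refl anti trans _] _] tot x0G; rewrite /min_vertex.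
case: pickP => [x _|no]; first by exists x.
case: (arg_minnP (fun x => #|rootpath G x|) x0G) => x xG xmin.
have/negP[] := negbT (no x); rewrite [_ \in _]xG /=; apply/forall_inP=> y yG.
have /orP[//|yx] := tot _ _ xG yG.
have sub : rootpath G y \subset rootpath G x.
  by apply/subsetP=> z; rewrite !inE => zy; apply: trans yx.
have /eqP E : rootpath G y == rootpath G x.
  by rewrite eqEcard sub; apply: xmin.
have : x \in rootpath G x by rewrite inE refl.
by rewrite -E inE.
Qed.

(** Ancestry will be expressed as reachability along these edges, which frees later arguments from
    the recursion in [ET_rec]. *)
Definition up_adj G u : rel T :=
  fun a b => [&& adj G a b, le G u a & le G u b].

Lemma up_adj_connect_le G u v :
  is_linear G -> u \in gV G -> connect (up_adj G u) u v -> le G u v.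
Proof.
case=> -[_ [_ refl _ _ _] _] _ uG uv.
have step a b : le G u a -> up_adj G u a b -> up_adj G u a b && le G u b.
  by move=> _ uab; rewrite uab; case/and3P: uab.
by have /andP[] := connect_morph (f := id) step (refl _ uG) uv.
Qed.

(** Since [u] is below [v], a path that stays above [v] also stays above [u]. This yields
    transitivity of the tree order. *)
Lemma up_adj_connect_trans G u v w : is_linear G ->
  u \in gV G -> connect (up_adj G u) u v -> connect (up_adj G v) v w ->
  connect (up_adj G u) u w.
Proof.
move=> lG uG uv vw; have le_uv := up_adj_connect_le lG uG uv.
apply: connect_trans uv _; apply: connect_sub vw => a b /and3P[ab va vb].
case: lG => -[_ [_ _ _ trans _] _] _.
by apply: connect1; rewrite /up_adj ab (trans _ _ _ le_uv va) (trans _ _ _ le_uv vb).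
Qed.

Lemma up_adj_connect_min G x u v :
  is_graph G -> {in gV G, forall y, le G x y} ->
  connect (adj G) u v -> connect (up_adj G x) u v.
Proof.
move=> gG xmin; apply: connect_sub => a b ab.
have /andP[aG bG] := adj_gV gG ab.
by apply: connect1; rewrite /up_adj ab !xmin.
Qed.

Lemma component_subset H K : K \in components H -> K \subset gV H.
Proof.
by case/imsetP=> x0 _ ->; apply/subsetP=> y; rewrite inE => /andP[].
Qed.

Lemma component_closed H K u v : is_graph H ->
  K \in components H -> u \in K -> adj H u v -> v \in K.
Proof.
move=> gH /imsetP[x0 _ ->]; rewrite !inE => /andP[_ x0u] uv.
have /andP[_ ->] := adj_gV gH uv.
exact: connect_trans x0u (connect1 uv).
Qed.

(** [K] is closed under adjacency in [induced G X], so a path there that starts in [K] never leaves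
    it. *)
Lemma component_connected G X K : is_graph G ->
  K \in components (induced G X) -> connected (induced G K).
Proof.
move=> gG KG; have gX := is_graph_induced X gG.
have closedK := component_closed gX KG.
have csym : connect_sym (adj (induced G X)) by apply: sym_connect_sym; case: gX.
case/imsetP: (KG) => x0 x0G EK; split.
  apply/set0Pn; exists x0; rewrite inE EK inE x0G connect0 !andbT.
  by move: x0G; rewrite inE => /andP[].
move=> u v; rewrite !inE => /andP[_ uK] /andP[_ vK].
have uv : connect (adj (induced G X)) u v.
  move: uK vK; rewrite EK !inE => /andP[_ x0u] /andP[_ x0v].
  by apply: connect_trans x0v; rewrite csym.
have step a b : a \in K -> adj (induced G X) a b ->
    adj (induced G K) a b && (b \in K).
  move=> aK ab; rewrite adj_induced aK (closedK _ _ aK ab) !andbT.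
  by move: ab; rewrite adj_induced => /andP[].
by have /andP[] := connect_morph (f := id) step uK uv.
Qed.

(** Every vertex is above the root, so for a root arc any path of the connected [G] serves; for a
    deeper arc, the path found inside its component is also a path of [G]. *)
Lemma ET_rec_sound n G e :
  is_linear G -> connected G -> e \in ET_rec n G ->
  [/\ e.1 \in gV G, e.2 \in gV G & connect (up_adj G e.1) e.1 e.2].
Proof.
elim: n G => [|n IHn] G lG cG; first by rewrite inE.
have gG : is_graph G by case: lG => -[].
rewrite /=; case Ex: (min_vertex G) => [x|]; last by rewrite inE.
have [xG xmin] := min_vertexP Ex.
case/bigcupP=> K KG; have cK := component_connected gG KG.
rewrite inE => /orP[|eK].
  rewrite inE => /andP[/eqP-> /eqP/esym/min_vertexP[mK _]].
  have mG : e.2 \in gV G by move: mK; rewrite inE => /andP[].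
  split=> //; apply: up_adj_connect_min => //.
  by case: cG => _; apply.
have [e1 e2 e12] := IHn _ (is_linear_induced K lG) cK eK.
move: e1 e2; rewrite !inE => /andP[-> _] /andP[-> _]; split=> //.
apply: connect_sub e12 => a b; rewrite /up_adj adj_induced !le_induced.
case/and3P=> /andP[ab _] /andP[ea _] /andP[eb _].
by apply: connect1; rewrite /up_adj ab ea eb.
Qed.

(** If [u] is the root, one arc leads to the minimum of the component of [v], and the induction
    continues from there. Otherwise the path stays above [u], so it avoids the root and remains in
    the component of [u]. *)
Lemma ET_rec_complete n G u v :
  is_linear G -> connected G -> #|gV G| <= n ->
  u \in gV G -> v \in gV G -> connect (up_adj G u) u v ->
  connect (arc (ET_rec n G)) u v.
Proof.
elim: n G u v => [|n IHn] G u v lG cG leGn uG vG uv.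
  by move: leGn uG; rewrite leqn0 cards_eq0 => /eqP->; rewrite inE.
have gG : is_graph G by case: lG => -[].
have [x Ex] := min_vertex_exists lG uG.
have [xG xmin] := min_vertexP Ex.
set G' := induced G (gV G :\ x).
have gG' : is_graph G' by apply: is_graph_induced.
have subET K : K \in components G' ->
    subrel (connect (arc (ET_rec n (induced G K))))
           (connect (arc (ET_rec n.+1 G))).
  move=> KG; apply: connect_sub => a b ab; apply: connect1.
  rewrite /arc /= Ex; apply/bigcupP; exists K => //.
  by rewrite inE [X in _ || X]ab orbT.
(* A component lacks the root [x], so depth [n] suffices for it. *)
have cardK K : K \in components G' -> #|gV (induced G K)| <= n.
  move=> KG; rewrite -ltnS; apply: leq_trans leGn; apply: proper_card.
  apply/properP; split; first exact: subsetIl.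
  exists x => //; rewrite inE xG /=; apply/negP=> /(subsetP (component_subset KG)).
  by rewrite !inE eqxx andbF.
have compP w : w \in gV G -> w != x -> exists2 K, K \in components G' & w \in K.
  move=> wG wx; have wG' : w \in gV G' by rewrite !inE wG wx.
  exists [set y in gV G' | connect (adj G') w y]; first exact: imset_f.
  by rewrite inE wG' connect0.
have [Eux|ux] := eqVneq u x.
  have [->|vx] := eqVneq v x; first by rewrite Eux connect0.
  have [K KG vK] := compP _ vG vx.
  have vGK : v \in gV (induced G K) by rewrite inE vG.
  have lK := is_linear_induced K lG; have cK := component_connected gG KG.
  have gK : is_graph (induced G K) by case: lK => -[].
  have [m Em] := min_vertex_exists lK vGK.
  have [mK mmin] := min_vertexP Em.
  apply: (@connect_trans _ _ m).
    apply: connect1; rewrite Eux /arc /= Ex; apply/bigcupP; exists K => //.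
    by rewrite !inE /= eqxx Em eqxx.
  apply: (subET K KG); apply: IHn => //; first exact: cardK.
  by apply: up_adj_connect_min => //; case: cK => _; apply.
have [K KG uK] := compP _ uG ux.
have refl_u : le G u u by case: lG => -[_ [_ refl _ _ _] _] _; apply: refl.
(* The root is below [u]; were it also above [u], antisymmetry would give [u = x]. *)
have notx w : le G u w -> w != x.
  case: lG => -[_ [_ _ anti _ _] _] _ uw; apply: contraNneq ux => Ew.
  by apply/eqP/anti; rewrite xmin // andbT -Ew.
have step a b : a \in K -> up_adj G u a b ->
    up_adj (induced G K) u a b && (b \in K).
  move=> aK /and3P[ab ua ub].
  have /andP[aG bG] := adj_gV gG ab.
  have bK : b \in K.
    apply: (component_closed gG' KG aK).
    by rewrite adj_induced ab !inE aG bG !notx.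
  by rewrite /up_adj adj_induced !le_induced ab ua ub uK bK aK.
have /andP[uvK vK] := connect_morph (f := id) step uK uv.
apply: (subET K KG); apply: IHn => //.
- exact: is_linear_induced.
- exact: component_connected KG.
- exact: cardK.
- by rewrite inE uG.
- by rewrite inE vG.
Qed.

(* The elimination tree order without the tree: [u] is an ancestor of [v] iff a
   path from [u] to [v] uses no vertex smaller than [u]. *)
Lemma le_rel_togP G u v : is_linear G -> connected G ->
  reflect [/\ u \in gV G, v \in gV G & connect (up_adj G u) u v]
          (le (rel_tog G) u v).
Proof.
move=> lG cG; rewrite /le !inE /=; apply: (iffP idP).
  case/andP=> /andP[uG vG] /connectP[p pET ->]; rewrite uG.
  elim: p u uG pET {v vG} => [|a p IHp] u uG /=; first by rewrite connect0.
  case/andP=> /(ET_rec_sound lG cG) /= [_ aG ua] /(IHp _ aG)[_ -> av].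
  by split=> //; apply: up_adj_connect_trans av.
by case=> uG vG uv; rewrite uG vG /=; apply: ET_rec_complete.
Qed.

Lemma le_rel_tog_sub G u v : is_linear G -> connected G ->
  le (rel_tog G) u v -> le G u v.
Proof. by move=> lG cG /le_rel_togP[]// uG _; apply: up_adj_connect_le. Qed.

Lemma rel_tog_order G : is_linear G -> connected G ->
  [/\ tle (rel_tog G) \subset setX (gV G) (gV G),
      {in gV G, reflexive (le (rel_tog G))},
      antisymmetric (le (rel_tog G)) & transitive (le (rel_tog G))].
Proof.
move=> lG cG; split.
- by apply/subsetP=> e; rewrite inE => /andP[].
- by move=> u uG; apply/le_rel_togP; rewrite // uG connect0.
- move=> u v /andP[/(le_rel_tog_sub lG cG) uv /(le_rel_tog_sub lG cG) vu].
  by case: lG => -[_ [_ _ anti _ _] _] _; apply: anti; rewrite uv.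
- move=> v u w /le_rel_togP[]// uG _ uv /le_rel_togP[]// _ wG vw.
  by apply/le_rel_togP; rewrite // uG wG; split=> //; apply: up_adj_connect_trans vw.
Qed.

(** An edge is by itself a path that stays above its smaller end. *)
Lemma adj_rel_tog_comparable G u v : is_linear G -> connected G ->
  adj G u v -> le (rel_tog G) u v || le (rel_tog G) v u.
Proof.
move=> lG cG uv; have [[gG [_ refl _ _ _] _] tot] := lG.
have /andP[uG vG] := adj_gV gG uv.
have vu : adj G v u by case: gG => _ ->.
have /orP[le_uv|le_vu] := tot _ _ uG vG; apply/orP; [left|right];
  apply/le_rel_togP=> //; split=> //; apply: connect1; rewrite /up_adj.
  by rewrite uv refl // le_uv.
by rewrite vu refl // le_vu.
Qed.

End EliminationTree.

(** * Pieces glued along the stem *)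

Section Gluing.
Variable T : finType.
Implicit Types (G D : tog T) (xs W : {set T}) (M Ep : {set T * T}).

(** Among the vertices above [v], take one with the fewest vertices above it. *)
Lemma exists_leaf_above G v :
  tle G \subset setX (gV G) (gV G) -> {in gV G, reflexive (le G)} ->
  antisymmetric (le G) -> transitive (le G) ->
  v \in gV G -> exists2 s, s \in leaves G & le G v s.
Proof.
move=> /subsetP sub refl anti trans vG.
case: (@arg_minnP _ v (le G v) (fun y => #|[set z | le G y z]|) (refl _ vG)).
move=> s vs smin; have sG : s \in gV G.
  by have := sub _ vs; rewrite inE => /andP[].
exists s => //; rewrite inE sG /=; apply/forall_inP=> y yG; apply/implyP=> sy.
have sub_y : [set z | le G y z] \subset [set z | le G s z].
  by apply/subsetP=> z; rewrite !inE; apply: trans.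
have /eqP/setP/(_ s) : [set z | le G y z] == [set z | le G s z].
  by rewrite eqEcard sub_y; apply: smin; apply: trans sy.
by rewrite !inE refl // => ys; apply/eqP/anti; rewrite ys.
Qed.

(** What both inclusions use of a decomposition. By the last field no relation, and hence no edge of
    an etog, joins the private parts of the two pieces. *)
Record glued G xs (G1 G2 : tog T) : Prop := Glued {
  glued_gV : gV G = gV G1 :|: gV G2;
  glued_cap : gV G1 :&: gV G2 = xs;
  glued_adj1 : {in gV G1 &, forall u v, adj G1 u v = adj G u v};
  glued_adj2 : {in gV G2 &, forall u v, adj G2 u v = adj G u v};
  glued_le1 : {in gV G1 &, forall u v, le G1 u v = le G u v};
  glued_le2 : {in gV G2 &, forall u v, le G2 u v = le G u v};
  glued_comparable : forall u v, le G u v || le G v u ->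
    [/\ u \in gV G1 & v \in gV G1] \/ [/\ u \in gV G2 & v \in gV G2]
}.

(** Pieces are closed downwards, so a piece containing the upper vertex of a comparable pair
    contains both. They cover [G] because every vertex has a leaf above it. *)
Lemma decomposition_glued G xs G1 G2 :
  tle G \subset setX (gV G) (gV G) -> {in gV G, reflexive (le G)} ->
  antisymmetric (le G) -> transitive (le G) ->
  is_decomposition G xs G1 G2 -> glued G xs G1 G2.
Proof.
move=> sub refl anti trans [S1 [S2 [_ _ eqS [-> ->] cap]]].
have down S u v : v \in gV (piece G S) -> le G u v -> u \in gV (piece G S).
  rewrite !inE => /andP[_ /bigcupP[s sS vs]] uv.
  have := subsetP sub _ uv; rewrite inE => /andP[-> _] /=.
  by apply/bigcupP; exists s => //; move: vs; rewrite !inE; apply: trans.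
have cover v : v \in gV G -> v \in gV (piece G S1) :|: gV (piece G S2).
  move=> vG; have [s] := exists_leaf_above sub refl anti trans vG.
  rewrite -eqS !inE vG => /orP[sS|sS] vs; apply/orP; [left|right];
    by apply/bigcupP; exists s => //; rewrite inE.
have inX S u : u \in gV (piece G S) -> u \in \bigcup_(x in S) rootpath G x.
  by rewrite inE => /andP[].
have comp u v : le G u v ->
    [/\ u \in gV (piece G S1) & v \in gV (piece G S1)] \/
    [/\ u \in gV (piece G S2) & v \in gV (piece G S2)].
  move=> uv; have := subsetP sub _ uv; rewrite inE => /andP[_ /= /cover].
  by rewrite in_setU => /orP[vS|vS]; [left|right]; split=> //; apply: down uv.
split=> //; try by
  move=> u v /inX uX /inX vX; rewrite ?adj_induced ?le_induced uX vX !andbT.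
- apply/setP=> v; apply/idP/idP; first exact: cover.
  by rewrite !inE -andb_orr => /andP[].
- by move=> u v /orP[/comp//|/comp[] []]; [left|right].
Qed.

(** * Identification along a matching *)

Lemma merge_image (kappa : T -> T) W x :
  {in W &, injective kappa} -> x \in W ->
  merge (matching_of kappa W) (kappa x) = x.
Proof.
move=> inj xW; rewrite /merge; case: pickP => [y|/(_ x)].
  by case/imsetP=> z zW [-> /inj->].
by rewrite imset_f.
Qed.

Lemma merge_id (kappa : T -> T) W v :
  v \notin kappa @: W -> merge (matching_of kappa W) v = v.
Proof.
move=> vW; rewrite /merge; case: pickP => // x /imsetP[z zW [_ Ev]].
by rewrite Ev imset_f in vW.
Qed.

Lemma adj_merged_graph G M Ep a b :
  adj G a b -> adj (merged_graph G M Ep) (merge M a) (merge M b).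
Proof.
by move=> ab; rewrite /adj !inE (imset_f (fun e => (merge M e.1, merge M e.2)) ab).
Qed.

Lemma adj_merged_graphP G M Ep u v :
  adj (merged_graph G M Ep) u v ->
  [\/ exists a b, [/\ adj G a b, u = merge M a & v = merge M b],
      (u, v) \in Ep | (v, u) \in Ep].
Proof.
rewrite /adj !inE -orbA => /or3P[/imsetP[[a b] ab [-> ->]]|uv|].
- by constructor 1; exists a, b.
- by constructor 2.
- by case/imsetP=> -[a b] ab [-> ->]; constructor 3.
Qed.

Lemma connected_merged_graph G M Ep :
  connected G -> connected (merged_graph G M Ep).
Proof.
case=> /set0Pn[x xG] cG; split.
  by apply/set0Pn; exists (merge M x); apply: imset_f.
move=> _ _ /imsetP[u uG ->] /imsetP[v vG ->].
have step a b : true -> adj G a b ->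
    adj (merged_graph G M Ep) (merge M a) (merge M b) && true.
  by move=> _ ab; rewrite andbT adj_merged_graph.
by have /andP[] := connect_morph (P := predT) step isT (cG _ _ uG vG).
Qed.

(* A path witnessing [u <= v] stays among the descendants of [u], so its image
   stays above [merge M u] in any order extending the merged one. *)
Lemma merge_le_rel_tog (L : tog T) M Ep lo (G := rel_tog L)
    (L' := Tog (merged_graph G M Ep) lo) u v :
  is_linear L -> connected L -> is_linear L' -> connected L' ->
  merged_order G M \subset lo ->
  le G u v -> le (rel_tog L') (merge M u) (merge M v).
Proof.
move=> lL cL lL' cL' /subsetP sub uv.
have leM a b : le G a b -> le L' (merge M a) (merge M b).
  move=> ab; have /le_rel_togP[//|//|aL bL _] := ab.
  apply: sub; rewrite !inE /= !imset_f //=.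
  have [->|neq] := eqVneq a b; first exact: connect0.
  apply: connect1.
  by apply: (imset_f (fun e => (merge M e.1, merge M e.2)) (x := (a, b)));
    rewrite inE neq andbT.
have /le_rel_togP[//|//|uL vL cuv] := uv.
apply/le_rel_togP=> //; split; try exact: imset_f.
have refl_u : le G u u by apply/le_rel_togP=> //; rewrite connect0.
(* The invariant is descent from [u] in the tree, not just in the order of [L], because [lo] is only
   known to extend the merged tree order. *)
have step a b : le G u a -> up_adj L u a b ->
    up_adj L' (merge M u) (merge M a) (merge M b) && le G u b.
  move=> ua ab; have /and3P[adj_ab _ _] := ab.
  have /andP[aL bL] : (a \in gV L) && (b \in gV L).
    by case: lL => -[gL _ _] _; apply: adj_gV.
  have ub : le G u b.
    have /le_rel_togP[//|//|_ _ cua] := ua.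
    by apply/le_rel_togP=> //; split=> //; apply: connect_trans cua (connect1 ab).
  by rewrite ub /up_adj (leM _ _ ua) (leM _ _ ub) !andbT adj_merged_graph.
by have /andP[] := connect_morph step refl_u cuv.
Qed.

(** * From generated etogs to defects *)

Lemma generated_is_defect (L : tog T) xs G1 G2 D (G := rel_tog L) :
  is_linear L -> connected L -> glued G xs G1 G2 ->
  generated_defect G xs G1 G2 D -> is_defect G xs G1 G2 D.
Proof.
move=> lL cL gl [W1 [W2 [kappa [Ep [lo []]]]]].
set M := matching_of kappa W1.
move=> [/subsetP sW1 /subsetP sW2 [kxs kinj kim kadj _]].
move=> [/subsetP sEp dEp Ep0] [lL' ext] ->.
have [EV Ecap adj1 adj2 le1 le2 comp] := gl.
set L' := Tog _ lo.
have cL' : connected L' by apply: connected_merged_graph.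
have mle := merge_le_rel_tog lL cL lL' cL' ext.
have compE u v : adj G u v ->
    [/\ u \in gV G1 & v \in gV G1] \/ [/\ u \in gV G2 & v \in gV G2].
  by move=> uv; apply/comp/adj_rel_tog_comparable.
have W1P x : x \in W1 -> x \in gV G1 /\ x \notin xs.
  by move/sW1; rewrite inE => /andP[-> ->].
have W2P x : x \in W2 -> x \in gV G2 /\ x \notin xs.
  by move/sW2; rewrite inE => /andP[-> ->].
have xsP x : (x \in xs) = (x \in gV G1) && (x \in gV G2) by rewrite -Ecap inE.
have W2G1 x : x \in W2 -> x \notin gV G1.
  by case/W2P=> x2; rewrite xsP x2 andbT.
(* The stem is fixed and disjoint from [W1] and [W2], so injectivity makes [kappa] carry [W1]
   exactly onto [W2]. *)
have kW : kappa @: W1 = W2.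
  apply/setP=> y; apply/imsetP/idP=> [[x xW ->]|yW].
    have : kappa x \in xs :|: W2 by rewrite -kim imset_f // inE xW orbT.
    rewrite inE => /orP[kx|//]; have [_ /negP[]] := W1P _ xW.
    by rewrite -(kinj (kappa x) x) ?inE ?kx ?xW ?orbT // kxs.
  have : y \in kappa @: (xs :|: W1) by rewrite kim inE yW orbT.
  case/imsetP=> x; rewrite inE => /orP[xx Ey|xW ->]; last by exists x.
  by have [_ /negP[]] := W2P _ yW; rewrite Ey kxs.
have kinjW : {in W1 &, injective kappa}.
  by move=> x y xW yW; apply: kinj; rewrite inE ?xW ?yW orbT.
have m1 v : v \in gV G1 -> merge M v = v.
  by move=> v1; apply: merge_id; rewrite kW; apply: contraL v1 => /W2G1.
have m2 x : x \in W1 -> merge M (kappa x) = x by apply: merge_image.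
(* A vertex of [G2] whose label lies in [G1] is a stem vertex or a merged one; either way [kappa]
   recovers it from its label. *)
have m4 v : v \in gV G2 -> merge M v \in gV G1 ->
    merge M v \in xs :|: W1 /\ kappa (merge M v) = v.
  move=> v2; have [|vW] := boolP (v \in kappa @: W1).
    by case/imsetP=> x xW ->; rewrite m2 // inE xW orbT.
  by rewrite merge_id // => v1; rewrite inE xsP v1 v2 kxs // xsP v1.
have m5 v : merge M v \notin gV G1 -> merge M v = v.
  have [|vW] := boolP (v \in kappa @: W1); last by rewrite merge_id.
  by case/imsetP=> x xW ->; rewrite m2 //; have [->] := W1P _ xW.
have minj2 : {in gV G2 &, injective (merge M)}.
  move=> u v u2 v2 E; have [w1|w1] := boolP (merge M u \in gV G1).
    have [_ <-] := m4 _ u2 w1; rewrite E in w1 *.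
    by have [_ ->] := m4 _ v2 w1.
  by rewrite -(m5 u w1) E m5 // -E.
have EpP a b : (a, b) \in Ep ->
    [/\ a \in gV G1, a \notin xs :|: W1, b \notin gV G1 & b \in gV G2].
  move/sEp; rewrite !inE /= => /andP[/and3P[aW ax a1] /and3P[bW bx b2]].
  rewrite a1 b2 negb_or ax aW; split=> //.
  by apply: contra bx => b1; rewrite xsP b1.
split.
- by exists L'.
(* Counting vertices makes [merge M] injective, so nothing is merged and [Ep] is nonempty. Counting
   edges then gives the contradiction. *)
- case=> phi [phiV phiI phiE _].
  have cphi : #|phi @: gV G| = #|gV G| by apply: card_in_imset.
  have sphi : phi @: gV G \subset merge M @: gV G.
    by apply/subsetP=> _ /imsetP[v vG ->]; apply: phiV.
  have /imset_injP minj : #|merge M @: gV G| == #|gV G|.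
    by rewrite eqn_leq leq_imset_card -{1}cphi subset_leq_card.
  have W10 : W1 = set0.
    apply/setP=> x; rewrite inE; apply/negP=> xW.
    have [x1 _] := W1P _ xW.
    have kxW : kappa x \in W2 by rewrite -kW imset_f.
    have [kx2 _] := W2P _ kxW.
    have /negP[] := W2G1 _ kxW.
    by rewrite -(minj x (kappa x)) ?EV ?inE ?x1 ?kx2 ?orbT // m2 // m1.
  have mid v : merge M v = v by apply: merge_id; rewrite W10 imset0 inE.
  have EV' : phi @: gV G = gV G.
    have EM : merge M @: gV G = gV G by rewrite (eq_imset _ mid) imset_id.
    by apply/eqP; rewrite eqEcard cphi leqnn andbT -{2}EM.
  have [[a b] abE] : exists e, e \in Ep.
    apply/set0Pn; apply/eqP=> /Ep0[/negP[]]; by rewrite W10.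
  (* [phi] is now onto the vertices of [D], so each edge of [D] is the image of an edge of [G],
     although [D] has all edges of [G] and at least one more. *)
  have sE : gE L' \subset (fun e => (phi e.1, phi e.2)) @: gE G.
    apply/subsetP=> -[u v] uv.
    have : (u \in gV L') && (v \in gV L').
      by case: lL' => -[gL' _ _] _; apply: adj_gV.
    rewrite /L' /= (eq_imset _ mid) imset_id -EV'.
    case/andP=> /imsetP[u' u'G Eu] /imsetP[v' v'G Ev].
    apply/imsetP; exists (u', v'); last by rewrite Eu Ev.
    by rewrite -[_ \in _]/(adj G u' v') phiE // -Eu -Ev.
  have : gE G \proper gE L'.
    apply/properP; split; last first.
      exists (a, b); first by rewrite !inE abE orbT.
      by apply: contraL abE => abG; rewrite (disjointFl dEp abG).
    by apply/subsetP=> -[u v] uv; have := adj_merged_graph M Ep uv; rewrite !mid.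
  move/proper_card; rewrite ltnNge => /negP[].
  exact: leq_trans (subset_leq_card sE) (leq_imset_card _ _).
- have sub1 v : v \in gV G1 -> v \in gV L'.
    by move=> v1; rewrite -(m1 v v1) imset_f // EV inE v1.
  split; first exact/subsetP.
  split=> //.
    move=> u v u1 v1; rewrite adj1 //; apply/idP/idP=> [uv|].
      by have := adj_merged_graph M Ep uv; rewrite !m1.
    case/adj_merged_graphP=> [[a [b [ab Eu Ev]]]|/EpP[_ _]|/EpP[_ _]];
      rewrite ?u1 ?v1 //.
    (* An edge of [G1] keeps its labels. For an edge of [G2], both labels lie in [xs :|: W1], and
       the isomorphism [kappa] shows that they are adjacent in [G]. *)
    case: (compE _ _ ab) => -[aG bG]; first by rewrite Eu Ev !m1.
    rewrite Eu in u1; rewrite Ev in v1.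
    have [uW Ea] := m4 _ aG u1; have [vW Eb] := m4 _ bG v1.
    by rewrite Eu Ev kadj // Ea Eb.
  by move=> u v u1 v1; rewrite le1 // => /mle; rewrite !m1.
exists (merge M); split.
- split=> //.
  + by move=> v v2; rewrite imset_f // EV inE v2 orbT.
  + move=> u v u2 v2; rewrite adj2 //; apply/idP/idP; first exact: adj_merged_graph.
    (* An added edge has an end in [G1] outside [xs :|: W1], which is not the label of any vertex of
       [G2]. *)
    case/adj_merged_graphP=> [[a [b [ab Eu Ev]]]|/EpP[w1 /negP[]]|/EpP[w1 /negP[]]];
      last 2 first.
    * by case: (m4 _ u2 w1).
    * by case: (m4 _ v2 w1).
    case: (compE _ _ ab) => -[aG bG]; last first.
      by rewrite (minj2 _ _ u2 aG Eu) (minj2 _ _ v2 bG Ev).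
    rewrite (m1 a aG) in Eu; rewrite (m1 b bG) in Ev.
    rewrite -Eu in aG ab; rewrite -Ev in bG ab.
    have [uW Ea] := m4 _ u2 aG; have [vW Eb] := m4 _ v2 bG.
    by rewrite -Ea -Eb -kadj.
  + by move=> u v u2 v2; rewrite le2 // => /mle.
- by move=> v; rewrite xsP => /andP[v1 _]; apply: m1.
- by move=> v _; apply: m5.
- rewrite /= [gV _]EV imsetU; congr (_ :|: _).
  rewrite -[RHS]imset_id; exact: eq_in_imset.
Qed.

(** * From defects to generated etogs *)

Lemma defect_is_generated (L : tog T) xs G1 G2 D (G := rel_tog L) :
  is_linear L -> connected L -> glued G xs G1 G2 ->
  is_defect G xs G1 G2 D -> generated_defect G xs G1 G2 D.
Proof.
move=> lL cL [EV Ecap adj1 adj2 le1 le2 comp].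
move=> [[L' [lL' cL' ->]] noemb [/subsetP sub1 [_ _ id_adj id_le]]].
move=> [phi [[phiV phiI phiE phi_le] phixs phiN EVD]].
have gL' : is_graph L' by case: lL' => -[].
have compE u v : adj G u v ->
    [/\ u \in gV G1 & v \in gV G1] \/ [/\ u \in gV G2 & v \in gV G2].
  by move=> uv; apply/comp/adj_rel_tog_comparable.
have xsP x : (x \in xs) = (x \in gV G1) && (x \in gV G2) by rewrite -Ecap inE.
set V1 := gV G1 :\: xs; set V2 := gV G2 :\: xs.
pose W2 := [set v in V2 | phi v \in gV G1].
pose W1 := phi @: W2.
(* [kappa] inverts [phi] on its whole image, not only on [W1], so it also fixes the stem. *)
pose kappa y := if [pick v in gV G2 | phi v == y] is Some v then v else y.
pose M := matching_of kappa W1.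
pose Ep := [set e in setX (V1 :\: W1) (V2 :\: W2) | e \in gE L'].
have kphi v : v \in gV G2 -> kappa (phi v) = v.
  move=> v2; rewrite /kappa; case: pickP => [w /andP[w2 /eqP E]|/(_ v)].
    exact: phiI.
  by rewrite v2 eqxx.
have W2P v : v \in W2 -> [/\ v \in gV G2, v \notin xs & phi v \in gV G1].
  by rewrite !inE => /andP[/andP[-> ->] ->].
have phi_xsW2 v : v \in gV G2 -> (phi v \in gV G1) = (v \in xs :|: W2).
  move=> v2; rewrite !inE v2 andbT; have [vx|//] := boolP (v \in xs).
  by rewrite phixs //; move: vx; rewrite xsP => /andP[->].
have xsW1P y : y \in xs :|: W1 ->
    exists2 v, (v \in gV G2) && (v \in xs :|: W2) & y = phi v.
  rewrite inE => /orP[yx|/imsetP[v vW ->]].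
    by exists y; rewrite ?inE ?yx ?phixs //=; move: yx; rewrite xsP => /andP[_ ->].
  by exists v => //; rewrite inE vW orbT; have [->] := W2P _ vW.
have phik y : y \in xs :|: W1 -> phi (kappa y) = y.
  by case/xsW1P=> v /andP[v2 _] ->; rewrite kphi.
have kG2 y : y \in xs :|: W1 -> kappa y \in gV G2.
  by case/xsW1P=> v /andP[v2 _] ->; rewrite kphi.
have W1G1 y : y \in xs :|: W1 -> y \in gV G1.
  by case/xsW1P=> v /andP[v2 vW] ->; rewrite phi_xsW2.
have kxs : {in xs, forall x, kappa x = x}.
  by move=> x xx; rewrite -{1}(phixs x xx) kphi //; move: xx; rewrite xsP => /andP[].
have kW : kappa @: W1 = W2.
  rewrite /W1 -imset_comp -[RHS]imset_id; apply: eq_in_imset => v /W2P[v2 _ _].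
  exact: kphi.
have kinj : {in xs :|: W1 &, injective kappa} by apply: can_in_inj phik.
have m1 v : v \in gV G1 -> merge M v = v.
  move=> v1; apply: merge_id; rewrite kW; apply/negP=> /W2P[v2 /negP[]].
  by rewrite xsP v1.
(* With [m1], [merge M] becomes the common extension of the two embeddings, the identity on [G1] and
   [phi] on [G2]. *)
have m2 v : v \in gV G2 -> merge M v = phi v.
  move=> v2; have [vW|vW] := boolP (v \in W2).
    rewrite -{1}(kphi v v2) merge_image ?imset_f //.
    by move=> x y xW yW; apply: kinj; rewrite inE ?xW ?yW orbT.
  rewrite merge_id ?kW //; have [vx|vx] := boolP (v \in xs); first by rewrite phixs.
  by rewrite phiN // phi_xsW2 // inE negb_or vx.
(* A strict relation lies in one piece, and the embedding of that piece is injective and order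
   preserving. *)
have strictP a b : (a, b) \in merge_arcs M (strict (tle G)) ->
    le (rel_tog L') a b /\ a != b.
  case/imsetP=> -[u v]; rewrite inE /= => /andP[uv neq] [-> ->].
  have /comp[[uG vG]|[uG vG]] : le G u v || le G v u by rewrite [le G u v]uv.
    by rewrite !m1 //; split=> //; apply: id_le => //; rewrite le1.
  rewrite !m2 //; split; first by apply: phi_le => //; rewrite le2.
  by apply: contraNneq neq => /phiI->.
have [_ reflD antiD transD] := rel_tog_order lL' cL'.
have EVM : merge M @: gV G = gV L'.
  rewrite EV imsetU [RHS]EVD; congr (_ :|: _); last exact: eq_in_imset.
  by rewrite -[RHS]imset_id; apply: eq_in_imset.
(* The end [b] outside [G1] must be the image of a vertex that [phi] fixes, so it is a private,
   unmerged vertex of [G2]. *)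
have EpP a b : adj L' a b -> a \in gV G1 -> a \notin phi @: gV G2 ->
    b \notin gV G1 -> (a, b) \in Ep.
  move=> ab a1 a2 b1; have /andP[_] := adj_gV gL' ab.
  rewrite [gV _]EVD inE (negPf b1) => /imsetP[v v2 Eb].
  have Ev : phi v = v by apply: phiN => //; rewrite -Eb.
  have [aW ax] : a \notin W1 /\ a \notin xs.
    split; apply: contra a2.
      by case/imsetP=> w /W2P[w2 _ _] ->; rewrite imset_f.
    move=> ax; rewrite -(phixs a ax) imset_f //.
    by move: ax; rewrite xsP => /andP[].
  rewrite Ev in Eb; rewrite inE [X in _ && X]ab andbT inE /= !in_setD ax aW a1.
  by rewrite Eb v2 xsP -Eb (negPf b1) andbT inE Eb Ev -Eb (negPf b1) andbF.
have symL' a b : adj L' a b = adj L' b a by case: gL' => _ ->.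
(* An edge of [D] within the image of one piece comes from that piece. Any other edge joins the
   private parts of the two images, and [EpP] applies in one of its two orientations. *)
have EE : gE (merged_graph G M Ep) = gE L'.
  apply/setP=> -[a b]; apply/idP/idP.
    case/adj_merged_graphP=> [[u [v [uv -> ->]]]||]; last 2 first.
    - by rewrite inE => /andP[].
    - by rewrite inE => /andP[_ ba]; rewrite -[_ \in _]/(adj L' a b) symL'.
    case: (compE _ _ uv) => -[uG vG].
      by rewrite !m1 // -[_ \in _]/(adj (rel_tog L') u v) -id_adj // adj1.
    by rewrite !m2 // -[_ \in _]/(adj (rel_tog L') _ _) -phiE // adj2.
  move=> ab; have /andP[aL bL] := adj_gV gL' ab.
  have both1 : a \in gV G1 -> b \in gV G1 -> adj (merged_graph G M Ep) a b.
    move=> a1 b1; rewrite -(m1 a a1) -(m1 b b1); apply: adj_merged_graph.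
    by rewrite -adj1 // id_adj.
  have both2 : a \in phi @: gV G2 -> b \in phi @: gV G2 ->
      adj (merged_graph G M Ep) a b.
    case/imsetP=> u u2 Ea /imsetP[v v2 Eb].
    rewrite Ea Eb -(m2 u u2) -(m2 v v2); apply: adj_merged_graph.
    by rewrite -adj2 // phiE // -Ea -Eb.
  have ba : adj L' b a by rewrite symL'.
  rewrite -[_ \in _]/(adj (merged_graph G M Ep) a b).
  move: (aL) (bL); rewrite [gV _]EVD !in_setU.
  have [a1|a1] := boolP (a \in gV G1); have [b1|b1] := boolP (b \in gV G1);
    rewrite ?orTb ?orFb.
  - by move=> _ _; apply: both1.
  - have [a2 _|a2 _ _] := boolP (a \in phi @: gV G2); first exact: both2.
    by rewrite /adj !in_setU (EpP _ _ ab a1 a2 b1) orbT.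
  - have [b2 a2 _|b2 _ _] := boolP (b \in phi @: gV G2); first exact: both2.
    rewrite /adj in_setU; apply/orP; right; apply/imsetP.
    by exists (b, a) => //; apply: EpP.
  - exact: both2.
have EH : merged_graph G M Ep = L'.
  move: EE; rewrite /merged_graph EVM /= => ->.
  by case: (tgraph L').
(* The linear order is the one that presents [D] as an etog. *)
exists W1, W2, kappa, Ep, (tle L') => /=.
have -> : Tog (merged_graph G (matching_of kappa W1) Ep) (tle L') = L'.
  by rewrite EH; case: (L').
(* If [phi v] were in the stem, [phi] would fix it, and injectivity would give [phi v = v], putting
   [v] in the stem. *)
have W1V1 : W1 \subset V1.
  apply/subsetP=> y yW; rewrite inE W1G1 ?inE ?yW ?orbT // andbT.
  case/imsetP: yW => v /W2P[v2 vx _] ->; apply: contra vx => px.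
  have p2 : phi v \in gV G2 by move: px; rewrite xsP => /andP[].
  by have <- : phi v = v by apply: phiI => //; apply: phixs.
split=> //.
- split=> //; first by apply/subsetP=> v; rewrite inE => /andP[].
  split=> //.
  + rewrite imsetU kW; congr (_ :|: _).
    by rewrite -[RHS]imset_id; apply: eq_in_imset.
  + move=> u v uW vW; rewrite -[adj G (kappa u) _]adj2 ?kG2 // phiE ?kG2 // !phik //.
    by rewrite -id_adj ?W1G1 // adj1 ?W1G1.
  + apply: (@acyclic_suborder _ _ (fun a b => le (rel_tog L') a b && (a != b))).
    * move=> b a c /andP[ab neq] /andP[bc _]; rewrite (transD _ _ _ ab bc) /=.
      by apply: contraNneq neq => Eac; apply/eqP/antiD; rewrite ab Eac.
    * by move=> a; rewrite eqxx andbF.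
    * by move=> a b /strictP[-> ->].
- split.
  + by apply/subsetP=> e; rewrite inE => /andP[].
  (* Pairs in [Ep] cross between the private parts, where [G] has no edges. *)
  + rewrite disjoint_subset; apply/subsetP=> -[a b]; rewrite !inE /=.
    case/andP=> /andP[/and3P[_ ax a1] /and3P[_ bx b2]] _; apply/negP=> ab.
    case: (compE _ _ ab) => -[aG bG].
      by move: bx; rewrite xsP bG b2.
    by move: ax; rewrite xsP aG a1.
  + move=> Ep0; suff W20 : W2 != set0.
      split=> //; apply: contra W20 => /eqP W10.
      by rewrite -kW W10 imset0.
    (* With nothing merged or added, [D] has the graph of [G] and an order containing that of [G],
       so the identity is a forbidden embedding. *)
    apply/negP=> /eqP W20; apply: noemb; exists id.
    have mid v : merge M v = v by apply: merge_id; rewrite kW W20 inE.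
    have subV v : v \in gV G -> v \in gV L'.
      by move=> vG; rewrite -EVM; apply/imsetP; exists v; rewrite ?mid.
    split=> //.
    * move=> u v uG vG; rewrite -[RHS]/(adj L' u v) -EH.
      apply/idP/idP=> [uv|].
        by have := adj_merged_graph M Ep uv; rewrite !mid.
      case/adj_merged_graphP=> [[a [b [ab -> ->]]]||]; rewrite ?Ep0 ?inE //.
      by rewrite !mid.
    * move=> u v uG vG uv /=.
      have [->|neq] := eqVneq u v; first exact/reflD/subV.
      have /strictP[//] : (u, v) \in merge_arcs M (strict (tle G)).
      by apply/imsetP; exists (u, v); rewrite ?mid // inE neq andbT.
- split=> //; apply/subsetP=> -[a b]; rewrite inE => /andP[].
  rewrite -/M EVM inE /= => /andP[aL bL] /connectP[p pM Eb].
  (* It suffices to stay in the tree order of [D], which is transitive and contains every merged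
     arc. *)
  apply: (le_rel_tog_sub lL' cL'); rewrite {b bL}Eb.
  elim: p a aL pM => [|c p IHp] a aL /=; first by move=> _; apply: reflD.
  case/andP=> /strictP[ac _] cp.
  have cV : c \in gV L' by case/le_rel_togP: (ac).
  exact: transD ac (IHp _ cV cp).
Qed.

End Gluing.

Theorem theorem1 (T : finType) (H : graph T) (bH H1 H2 : tog T) (xs : {set T}) :
  is_graph H -> connected H ->
  pattern_relaxation H bH ->
  is_stem bH xs ->
  is_decomposition bH xs H1 H2 ->
  forall D : tog T,
    generated_defect bH xs H1 H2 D <-> is_defect bH xs H1 H2 D.
Proof.
move=> _ cH [lo [lL ->]] _ dec D.
have [sub refl anti trans] := rel_tog_order lL cH.
have gl := decomposition_glued sub refl anti trans dec.
split; first exact: generated_is_defect gl.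
exact: defect_is_generated gl.
Qed.
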